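(* Let $G$ be a Hausdorff topological group, $(X,\theta)$ a $G$-space, $X_G$ its enveloping space and $n\ge 0$ an integer. If $\theta$ is nice, then: (a) $X$ is locally contractible if and only if $X_G$ is locally contractible; (b) $X$ is $\mathrm{LC}^n$ if and only if $X_G$ is $\mathrm{LC}^n$.
   Context: Partial actions. A partial action of a group $G$ (identity $e$) on a set $X$ is a map $\theta:G*X\to X$, $(g,x)\mapsto g\cdot x$, defined on a subset $G*X\subseteq G\times X$ (write $\exists\, g\cdot x$ for $(g,x)\in G*X$), such that for all $g,h\in G$, $x\in X$: (PA1) if $\exists\, g\cdot x$ then $\exists\, g^{-1}\cdot(g\cdot x)$ and $g^{-1}\cdot(g\cdot x)=x$; (PA2) if $\exists\, g\cdot(h\cdot x)$ then $\exists\,(gh)\cdot x$ and $g\cdot(h\cdot x)=(gh)\cdot x$; (PA3) $\exists\, e\cdot x$ and $e\cdot x=x$. Put $X_g=\{x\in X:\exists\, g^{-1}\cdot x\}$, $\theta_g:X_{g^{-1}}\to X_g$, $x\mapsto g\cdot x$. If $G$ is a topological group and $X$ a topological space, $\theta$ is topological if every $X_g$ is open in $X$ and every $\theta_g$ is a homeomorphism; continuous if $\theta$ is continuous for the subspace topology on $G*X\subseteq G\times X$; nice if it is continuous and $G*X$ is open in $G\times X$. All topological groups are Hausdorff and all partial actions are topological. A $G$-space is a pair $(X,\theta)$ with $\theta$ a continuous (topological) partial action of $G$ on the topological space $X$. Enveloping space. $X_G=(G\times X)/R$ with the quotient topology, where $(g,x)R(h,y)$ iff $x\in X_{g^{-1}h}$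 and $\theta_{h^{-1}g}(x)=y$; the class of $(g,x)$ is $[g,x]$. $G$ acts on $X_G$ globally and continuously by $\mu(g,[h,x])=[gh,x]$. Local properties. A space $X$ is locally contractible if for each $x\in X$ and each neighborhood $U$ of $x$ there is a neighborhood $V\subseteq U$ of $x$ that is contractible in $U$, i.e. there is a continuous $H:V\times[0,1]\to U$ with $H_0$ the inclusion and $H_1$ a constant map. $X$ is $\mathrm{LC}^n$ if for every $x\in X$, every neighborhood $U$ of $x$ and every $0\le m\le n$ there is a neighborhood $V\subseteq U$ of $x$ such that every continuous $f:S^m\to V$ extends to a continuous $F:B^{m+1}\to U$ ($S^m$ the unit $m$-sphere, $B^{m+1}$ the unit $(m+1)$-ball). *)

(* Defs.v *)
From HB Require Import structures.
From mathcomp Require Import all_boot all_order all_algebra.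
From mathcomp Require Import all_classical all_reals all_analysis.

Set Implicit Arguments.
Unset Strict Implicit.
Unset Printing Implicit Defensive.

Import Order.TTheory GRing.Theory Num.Theory.
Import numFieldNormedType.Exports.

Local Open Scope quotient_scope.
Local Open Scope classical_set_scope.
Local Open Scope ring_scope.

(* Separation is not part of the structure; statements assume
   [hausdorff_space G] separately. *)
HB.mixin Record Topological_isTopologicalGroup G
    of Topological G & Group G := {
  mulg_continuous : continuous (fun p : G * G => (p.1 * p.2)%g);
  invg_continuous : continuous (fun g : G => (g^-1)%g)
}.

#[short(type="topologicalGroupType")]
HB.structure Definition TopologicalGroup :=
  {G of Topological G & Group G & Topological_isTopologicalGroup G}.

(* A partial map G * X -> X is a total function together with a domain [pdom];
   the values of [pact] outside [pdom] are junk and are never used. *)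
Record partial_action (G : groupType) (X : Type) := PartialAction {
  pdom : set (G * X);
  pact : G * X -> X;
  pact_inv : forall g x, pdom (g, x) ->
    pdom ((g^-1)%g, pact (g, x)) /\ pact ((g^-1)%g, pact (g, x)) = x;
  pact_mul : forall g h x, pdom (h, x) -> pdom (g, pact (h, x)) ->
    pdom ((g * h)%g, x) /\ pact (g, pact (h, x)) = pact ((g * h)%g, x);
  pact_one : forall x, pdom (1%g, x) /\ pact (1%g, x) = x
}.

(* X_g *)
Definition pset (G : groupType) (X : Type) (theta : partial_action G X)
    (g : G) : set X :=
  [set x | pdom theta ((g^-1)%g, x)].

(* theta_g, meaningful on [pset theta g^-1] *)
Definition pmap_at (G : groupType) (X : Type) (theta : partial_action G X)
    (g : G) : X -> X :=
  fun x => pact theta (g, x).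

(* f restricts to a homeomorphism of the subspace A onto the subspace B. *)
Definition homeomorphism_between (S T : topologicalType)
    (A : set S) (B : set T) (f : S -> T) : Prop :=
  exists f' : T -> S,
    [/\ set_fun A B f, set_fun B A f',
        {in A, cancel f f'}, {in B, cancel f' f} &
        {within A, continuous f} /\ {within B, continuous f'}].

Section PartialActionTopology.
Context {G : topologicalGroupType} {X : topologicalType}.
Implicit Type theta : partial_action G X.

Definition topological_paction theta : Prop :=
  (forall g, open (pset theta g)) /\
  (forall g, homeomorphism_between
               (pset theta (g^-1)%g) (pset theta g) (pmap_at theta g)).

Definition continuous_paction theta : Prop :=
  {within pdom theta, continuous (pact theta)}.

Definition nice_paction theta : Prop :=
  continuous_paction theta /\ open (pdom theta).

Definition is_Gspace theta : Prop :=
  topological_paction theta /\ continuous_paction theta.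

End PartialActionTopology.

Section Enveloping.
Context {G : topologicalGroupType} {X : topologicalType}.
Variable theta : partial_action G X.

Definition env_rel (p q : G * X) : Prop :=
  pset theta (p.1^-1 * q.1)%g p.2 /\ pmap_at theta (q.1^-1 * p.1)%g p.2 = q.2.

Definition env_relb : rel (G * X) := fun p q => `[< env_rel p q >].

Lemma env_relP p q : env_rel p q <->
  pdom theta ((q.1^-1 * p.1)%g, p.2) /\
  pact theta ((q.1^-1 * p.1)%g, p.2) = q.2.
Proof. by rewrite /env_rel /pset /pmap_at /= invgM invgK. Qed.

Lemma env_rel_refl : reflexive env_relb.
Proof.
by move=> [g x]; apply/asboolP/env_relP; rewrite /= mulVg; exact: pact_one.
Qed.

Lemma env_rel_imp_sym p q : env_rel p q -> env_rel q p.
Proof.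
case: p q => [g x] [h y] /env_relP /= [hd he]; apply/env_relP => /=.
have [] := pact_inv hd; by rewrite invgM invgK he.
Qed.

Lemma env_rel_sym : symmetric env_relb.
Proof. by move=> p q; apply/asboolP/asboolP; exact: env_rel_imp_sym. Qed.

Lemma env_rel_trans : transitive env_relb.
Proof.
move=> [h y] [g x] [k z] /asboolP/env_relP /= [d1 e1] /asboolP/env_relP /= [d2 e2].
apply/asboolP/env_relP => /=; rewrite -e1 in d2 e2.
have [] := pact_mul d1 d2; by rewrite -mulgA [(h * _)%g]mulgA mulgV mul1g e2 => ? <-.
Qed.

Definition env_equiv : equiv_rel (G * X) :=
  EquivRel env_relb env_rel_refl env_rel_sym env_rel_trans.

(* X_G *)
Definition enveloping_space : topologicalType :=
  quotient_topology {eq_quot env_equiv}.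

End Enveloping.

Section LocalProperties.
Context (R : realType).

Definition contractible_in (T : topologicalType) (V U : set T) : Prop :=
  exists H : T * R -> T,
    [/\ {within V `*` `[0, 1], continuous H},
        set_fun (V `*` `[0, 1]) U H,
        forall x, V x -> H (x, 0) = x &
        exists c : T, forall x, V x -> H (x, 1) = c].

Definition locally_contractible (T : topologicalType) : Prop :=
  forall (x : T) (U : set T), nbhs x U ->
    exists V : set T, [/\ nbhs x V, V `<=` U & contractible_in V U].

(* The norm carried by ['rV[R]_k] in the library is the sup norm. *)
Definition euclidean_norm (k : nat) (v : 'rV[R]_k) : R :=
  Num.sqrt (\sum_(i < k) v ord0 i ^+ 2).

(* S^m, in R^(m+1) *)
Definition unit_sphere (m : nat) : set 'rV[R]_m.+1 :=
  [set v | euclidean_norm v = 1].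
Arguments unit_sphere : clear implicits.

(* B^k, in R^k *)
Definition unit_ball (k : nat) : set 'rV[R]_k :=
  [set v | euclidean_norm v <= 1].
Arguments unit_ball : clear implicits.

Definition LC (n : nat) (T : topologicalType) : Prop :=
  forall (x : T) (U : set T) (m : nat), nbhs x U -> (m <= n)%N ->
    exists V : set T, [/\ nbhs x V, V `<=` U &
      forall f : 'rV[R]_m.+1 -> T,
        {within unit_sphere m, continuous f} -> set_fun (unit_sphere m) V f ->
        exists F : 'rV[R]_m.+1 -> T,
          [/\ {within unit_ball m.+1, continuous F},
              set_fun (unit_ball m.+1) U F &
              {in unit_sphere m, F =1 f}]].

End LocalProperties.

(* Main.v *)
(** For each g, the map x |-> [g, x] is a homeomorphism of X onto an open subset
    of X_G: it is injective because partial actions are, and it is open because,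
    for U open, the saturation of {g} x U in G x X consists of the (h, y) with
    (g^-1 h, y) in the open set G*X and (g^-1 h) . y in U. These open sets cover
    X_G, and both properties are local, hence transfer between X and X_G. *)
Require Import Defs.
From HB Require Import structures.
From mathcomp Require Import all_boot all_order all_algebra.
From mathcomp Require Import all_classical all_reals all_analysis.

Set Implicit Arguments.
Unset Strict Implicit.
Unset Printing Implicit Defensive.

Import Order.TTheory GRing.Theory Num.Theory.
Import numFieldNormedType.Exports.

Local Open Scope quotient_scope.
Local Open Scope classical_set_scope.
Local Open Scope ring_scope.

(** Points of [A] near [x] land in [B], the only place where continuity of [g] is known, so the
    inclusion of [f A] in [B] is what makes the two relative limits compose. *)
Lemma within_continuous_comp_set_fun (S T U : topologicalType) (A : set S)
    (B : set T) (f : S -> T) (g : T -> U) :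
  set_fun A B f -> {within A, continuous f} -> {within B, continuous g} ->
  {within A, continuous (g \o f)}.
Proof.
move=> fAB /subspace_continuousP cf /subspace_continuousP cg.
apply/subspace_continuousP => x Ax W /(cg _ (fAB _ Ax)) W'.
apply: (@filterS _ (nbhs x) _ _ _ _ (cf _ Ax _ W')) => y /= + Ay.
by move=> /(_ Ay) /(_ (fAB _ Ay)).
Qed.

(** Relative continuity yields a neighbourhood in the subspace [A]; openness of [A] turns it into
    one in [S]. *)
Lemma nbhs_within_preimage (S T : topologicalType) (A : set S) (f : S -> T) (x : S) (U : set T) :
  open A -> {within A, continuous f} -> A x -> nbhs (f x) U ->
  nbhs x (A `&` f @^-1` U).
Proof.
move=> oA; rewrite continuous_open_subspace// => cf Ax Ufx.
by apply: filterI; [exact: open_nbhs_nbhs|exact: (cf _ (mem_set Ax))].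
Qed.

Section local_properties_at_a_point.
Variable R : realType.

(** Pointwise form, because a chart compares two spaces only near one point at a time. *)
Definition locally_contractible_at (T : topologicalType) (x : T) : Prop :=
  forall U : set T, nbhs x U ->
    exists V : set T, [/\ nbhs x V, V `<=` U & contractible_in R V U].

Definition LC_at (n : nat) (T : topologicalType) (x : T) : Prop :=
  forall (U : set T) (m : nat), nbhs x U -> (m <= n)%N ->
    exists V : set T, [/\ nbhs x V, V `<=` U &
      forall f : 'rV[R]_m.+1 -> T,
        {within @unit_sphere R m, continuous f} ->
        set_fun (@unit_sphere R m) V f ->
        exists F : 'rV[R]_m.+1 -> T,
          [/\ {within @unit_ball R m.+1, continuous F},
              set_fun (@unit_ball R m.+1) U F &
              {in @unit_sphere R m, F =1 f}]].

Variables (S T : topologicalType) (A : set S) (B : set T) (f : S -> T).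
Hypotheses (oA : open A) (oB : open B) (homf : homeomorphism_between A B f).

(** A contraction [H] near [x] is conjugated into [(y, t) |-> f (H (g y, t))], where [g] is the
    inverse of [f]. *)
Lemma locally_contractible_at_homeo x : A x ->
  locally_contractible_at x -> locally_contractible_at (f x).
Proof.
move=> Ax lcx U Ufx; have [g [fAB gBA fK gK [cf cg]]] := homf.
have gfx : g (f x) = x by rewrite fK ?inE.
(* Shrinking to [A] intersected with the preimage of [U] keeps the whole homotopy inside [A], where
   [f] is continuous. *)
have [V [Vx VU [H [cH HVU H0 [c H1]]]]] :=
  lcx _ (nbhs_within_preimage oA cf Ax Ufx).
exists (B `&` g @^-1` V); split.
- by apply: nbhs_within_preimage => //; [exact: fAB|rewrite gfx].
- by move=> y [By /VU[_]]; rewrite /= gK ?inE.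
exists (fun p => f (H (g p.1, p.2))); split.
- pose gI (p : T * R) := (g p.1, p.2).
  have gIV : set_fun ((B `&` g @^-1` V) `*` `[0, 1]) (V `*` `[0, 1]) gI.
    by move=> [y t] [/= [By Vgy] t01].
  have cgI : {within (B `&` g @^-1` V) `*` `[0, 1], continuous gI}.
    have /subspace_continuousP cg1 :
        {within (B `&` g @^-1` V) `*` `[0, 1 : R], continuous (g \o fst)}.
      apply: (within_continuous_comp_set_fun (B := B)) => //.
        by move=> [y t] [[]].
      by apply: continuous_subspaceT => p; exact: cvg_fst.
    apply/subspace_continuousP => p Wp.
    have cI : snd @ within ((B `&` g @^-1` V) `*` `[0, 1 : R]) (nbhs p) --> p.2.
      by apply: cvg_within_filter; exact: cvg_snd.
    exact: cvg_pair (cg1 p Wp) cI.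
  apply: (within_continuous_comp_set_fun (B := A)
    _ (within_continuous_comp_set_fun gIV cgI cH) cf).
  by move=> p /gIV /HVU[].
- by move=> [y t] [/= [By Vgy] t01]; have [] := HVU (g y, t) (conj Vgy t01).
- by move=> y [By Vgy] /=; rewrite H0// gK ?inE.
- by exists (f c) => y [By Vgy] /=; rewrite H1.
Qed.

(** A sphere near [f x] is pulled back by the inverse [g], filled inside [A], and the filling is
    pushed forward by [f]. *)
Lemma LC_at_homeo n x : A x -> LC_at n x -> LC_at n (f x).
Proof.
move=> Ax lcx U m Ufx mn; have [g [fAB gBA fK gK [cf cg]]] := homf.
have gfx : g (f x) = x by rewrite fK ?inE.
have [V [Vx VU ext]] := lcx _ _ (nbhs_within_preimage oA cf Ax Ufx) mn.
exists (B `&` g @^-1` V); split.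
- by apply: nbhs_within_preimage => //; [exact: fAB|rewrite gfx].
- by move=> y [By /VU[_]]; rewrite /= gK ?inE.
move=> u cu uW.
have [||F [cF FU Fu]] := ext (g \o u).
- apply: (within_continuous_comp_set_fun (B := B)) => //.
  by move=> v /uW[].
- by move=> v /uW[].
exists (f \o F); split.
- apply: (within_continuous_comp_set_fun (B := A)) => //.
  by move=> v /FU[].
- by move=> v /FU[].
- by move=> v vS /=; rewrite Fu//= gK// inE; have [] := uW v (set_mem vS).
Qed.

End local_properties_at_a_point.

(** Lets the transfer lemmas run backwards; the cancellation identifies the point reached. *)
Lemma homeomorphism_between_inv (S T : topologicalType) (A : set S) (B : set T)
    (f : S -> T) : homeomorphism_between A B f ->
  exists2 g, homeomorphism_between B A g & {in A, cancel f g}.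
Proof. by move=> [g [? ? ? ? [? ?]]]; exists g => //; exists f. Qed.

Lemma open_embedding_homeomorphism (S T : topologicalType) (f : S -> T) (x : S) :
  continuous f -> injective f -> (forall U, open U -> open (f @` U)) ->
  homeomorphism_between setT (range f) f.
Proof.
move=> cf injf opf; pose g y := xget x [set s | f s = y].
(* Off the range of [f], the inverse [g] takes the default value [x]. *)
have gK y : range f y -> f (g y) = y.
  by move=> [s _ fs]; exact: (@xgetPex _ x [set s | f s = y] (ex_intro _ s fs)).
have fK s : g (f s) = s by apply: injf; apply: gK; exists s.
exists g; split => //.
- by move=> y /set_mem; exact: gK.
- split; first exact: continuous_subspaceT.
  rewrite continuous_open_subspace; last exact/opf/openT.
  apply/continuous_inP; first exact/opf/openT.
  (* The preimage of [U] under [g], cut down to the range, is the image of [U] under [f], hence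
     open. *)
  move=> U /opf; congr open; apply/seteqP; split => y.
    by move=> [s Us <-]; split; [exists s|rewrite /= fK].
  by move=> [fy Ugy]; exists (g y) => //; exact: gK.
Qed.

Section env_charts.
Context {G : topologicalGroupType} {X : topologicalType}.
Variable theta : partial_action G X.

Definition env_class (p : G * X) : enveloping_space theta :=
  \pi_(enveloping_space theta) p.

Lemma env_class_eq (p q : G * X) :
  env_class p = env_class q <->
  pdom theta ((q.1^-1 * p.1)%g, p.2) /\
  pact theta ((q.1^-1 * p.1)%g, p.2) = q.2.
Proof.
split=> [/eqmodP/asboolP/env_relP//|pq].
by apply/eqmodP/asboolP/env_relP.
Qed.

Definition env_chart (g : G) (x : X) : enveloping_space theta :=
  env_class (g, x).

Lemma env_chart_surj (z : enveloping_space theta) :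
  exists g x, z = env_chart g x.
Proof.
exists (repr z).1, (repr z).2.
by rewrite /env_chart /env_class -surjective_pairing reprK.
Qed.

Lemma env_chart_continuous g : continuous (env_chart g).
Proof.
move=> x; apply: (@continuous_comp _ _ _ (pair g) env_class).
  by apply: cvg_pair; [exact: cvg_cst|exact: cvg_id].
exact: pi_continuous.
Qed.

Lemma env_chart_inj g : injective (env_chart g).
Proof.
move=> x y /env_class_eq /= []; rewrite mulVg => _.
by rewrite (pact_one theta x).2.
Qed.

Lemma translate_fst_continuous (g : G) :
  continuous (fun p : G * X => ((g * p.1)%g, p.2)).
Proof.
move=> p; apply: cvg_pair; last exact: cvg_snd.
apply: (@continuous_comp _ _ _ (fun p : G * X => (g, p.1))
  (fun q : G * G => (q.1 * q.2)%g)).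
  by apply: cvg_pair; [exact: cvg_cst|exact: cvg_fst].
exact: mulg_continuous.
Qed.

Lemma env_chart_open g (U : set X) :
  nice_paction theta -> open U -> open (env_chart g @` U).
Proof.
move=> [ctheta odom] oU.
have : open ((fun p : G * X => ((g^-1 * p.1)%g, p.2)) @^-1`
    (pdom theta `&` pact theta @^-1` U)).
  apply: open_comp; first by move=> p _; exact: translate_fst_continuous.
  (* Since [pdom theta] is open, relative continuity of the action gives a set open in [G * X]
     itself. *)
  apply: (proj1 (continuous_inP _ odom)) => //.
  by rewrite -continuous_open_subspace.
(* Open in the quotient means open preimage in [G * X]. The two sets agree because [[h, y] = [g, z]]
   exactly when [z] is the defined value of [g^-1 h] at [y]. *)
congr open; apply/seteqP; split => -[h y] /=.
  by move=> [dy Uy]; exists (pact theta ((g^-1 * h)%g, y)) => //;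
    apply/esym/env_class_eq.
by move=> [x Ux /esym/env_class_eq/= [dy ->]].
Qed.

End env_charts.

Theorem proposition4p2 (R : realType) (G : topologicalGroupType)
    (X : topologicalType) (theta : partial_action G X) (n : nat)
    (hausdorffG : hausdorff_space G)
    (GspaceX : is_Gspace theta)
    (nice_theta : nice_paction theta) :
  (locally_contractible R X <->
   locally_contractible R (enveloping_space theta)) /\
  (LC R n X <-> LC R n (enveloping_space theta)).
Proof.
have chart_homeo g (x : X) :
    homeomorphism_between setT (range (env_chart theta g)) (env_chart theta g).
  apply: (open_embedding_homeomorphism x).
  - exact: env_chart_continuous.
  - exact: env_chart_inj.
  - by move=> U; exact: env_chart_open.
have open_range g : open (range (env_chart theta g)).
  by apply: env_chart_open => //; exact: openT.
split; split.
- move=> lcX z; have [g [x ->]] := env_chart_surj z.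
  exact: (locally_contractible_at_homeo openT (open_range g) (chart_homeo g x)
    I (lcX x)).
(* The chart at the identity of [G] covers every [x]: its inverse [r] carries the property from
   [[1, x]] back to [x]. *)
- move=> lcE x.
  have [r homr rK] := homeomorphism_between_inv (chart_homeo 1%g x).
  rewrite -(rK x) ?inE//.
  by apply: (locally_contractible_at_homeo (open_range 1%g) openT homr);
    [exists x|exact: lcE].
- move=> lcX z; have [g [x ->]] := env_chart_surj z.
  exact: (LC_at_homeo openT (open_range g) (chart_homeo g x) I (lcX x)).
- move=> lcE x.
  have [r homr rK] := homeomorphism_between_inv (chart_homeo 1%g x).
  rewrite -(rK x) ?inE//.
  by apply: (LC_at_homeo (open_range 1%g) openT homr); [exists x|exact: lcE].
Qed.
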